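(* For every integer $n\ge 2$, $$\liminf_{H\to\infty}\frac{\#\overline{\mathcal{E}}_n(H)}{\#\mathcal{E}_n(H)}\ge 1+\gamma_n,$$ where $$\gamma_n=\frac{1}{2^{n^2+n}}\left(1-\frac{\tau_n}{\rho_n}\right)>0.$$
   Context: A polynomial $f(x)=a_nx^n+\cdots+a_1x+a_0\in\mathbb{Z}[x]$ of degree $n$ is called Eisenstein if there is a prime $p$ such that (i) $p\mid a_i$ for $i=0,\ldots,n-1$, (ii) $p^2\nmid a_0$, (iii) $p\nmid a_n$. It is called a shifted Eisenstein polynomial if there exists an integer $s$ such that $f(x+s)$ is Eisenstein. The height is $H(f)=\max_{0\le i\le n}|a_i|$. $\mathcal{E}_n(H)$ denotes the set of Eisenstein polynomials in $\mathbb{Z}[x]$ of degree $n$ and height at most $H$, and $\overline{\mathcal{E}}_n(H)$ denotes the set of shifted Eisenstein polynomials in $\mathbb{Z}[x]$ of degree $n$ and height at most $H$. With sums and products over all primes $p$, $$\rho_n=1-\prod_p\left(1-\frac{(p-1)^2}{p^{n+2}}\right),\qquad \tau_n=\left(\sum_p\frac{(p-1)^2}{p^{n+2}}\right)^2-\sum_p\frac{(p-1)^4}{p^{2n+4}}.$$ *)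

(* Defs.v *)
(* Library: MathComp + MathComp-Analysis *)
From mathcomp Require Import all_boot all_order all_algebra finmap.
From mathcomp Require Import all_classical all_reals all_analysis.

Set Implicit Arguments.
Unset Strict Implicit.
Unset Printing Implicit Defensive.

Import Order.TTheory GRing.Theory Num.Theory.
Import numFieldNormedType.Exports.

Local Open Scope classical_set_scope.
Local Open Scope ring_scope.

Definition eisenstein_at (p : nat) (f : {poly int}) : Prop :=
  [/\ forall i : nat, (i < (size f).-1)%N -> (p %| f`_i)%Z,
      ~~ ((p ^ 2)%N %| f`_0)%Z
    & ~~ (p %| lead_coef f)%Z].

Definition eisenstein (f : {poly int}) : Prop :=
  exists2 p : nat, prime p & eisenstein_at p f.

Definition shifted_eisenstein (f : {poly int}) : Prop :=
  exists s : int, eisenstein (f \Po ('X + s%:P)).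

Definition height (f : {poly int}) : nat := \max_(i < size f) `|(f`_i)%R|%N.

Definition bounded_poly (n H : nat) : set {poly int} :=
  [set f : {poly int} | size f = n.+1 /\ (height f <= H)%N].

Lemma finite_bounded_poly (n H : nat) : finite_set (bounded_poly n H).
Proof.
pose g (u : {ffun 'I_n.+1 -> 'I_H.+1 * bool}) : {poly int} :=
  \poly_(i < n.+1) ((-1) ^+ (u (inord i)).2 * ((u (inord i)).1 : nat)%:Z).
apply: (@sub_finite_set _ _ (g @` setT)); last exact: finite_image.
move=> f [sf hf].
exists [ffun i : 'I_n.+1 => (inord `|(f`_i)%R|%N, f`_i < 0)] => //.
apply/polyP => i; rewrite coef_poly; case: ltnP => [lin|]; last first.
  by rewrite -sf => /(nth_default 0) ->.
rewrite ffunE /= inordK // inordK; first by rewrite abszE -intEsign.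
rewrite ltnS (leq_trans _ hf) // /height.
have li : (i < size f)%N by rewrite sf.
exact: (leq_bigmax (Ordinal li) (F := fun j : 'I_(size f) => `|(f`_j)%R|%N)).
Qed.

Definition Eis (n H : nat) : set {poly int} :=
  [set f | bounded_poly n H f /\ eisenstein f].

Definition shiftedEis (n H : nat) : set {poly int} :=
  [set f | bounded_poly n H f /\ shifted_eisenstein f].

(* [fset_set] is the empty set on infinite sets; it is only used here on subsets
   of [bounded_poly n H], which are finite by [finite_bounded_poly]. *)
Definition card_set (A : set {poly int}) : nat := #|` fset_set A|%fset.

(* [limn] is arbitrary on divergent sequences.  For [2 <= n] the limits in
   [eis_rho] and [eis_tau] exist, since 0 <= local_density R n p <= 1 / p^n. *)
Definition prime_sum (R : realType) (F : nat -> R) : R :=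
  limn (fun N => \sum_(0 <= p < N | prime p) F p).

Definition prime_prod (R : realType) (F : nat -> R) : R :=
  limn (fun N => \prod_(0 <= p < N | prime p) F p).

Definition local_density (R : realType) (n p : nat) : R :=
  (p%:R - 1) ^+ 2 / p%:R ^+ (n + 2).

Definition eis_rho (R : realType) (n : nat) : R :=
  1 - prime_prod (fun p => 1 - local_density R n p).

Definition eis_tau (R : realType) (n : nat) : R :=
  prime_sum (local_density R n) ^+ 2 -
  prime_sum (fun p => (p%:R - 1) ^+ 4 / p%:R ^+ (2 * n + 4)).

Definition eis_gamma (R : realType) (n : nat) : R :=
  1 / 2 ^+ (n ^ 2 + n) * (1 - eis_tau R n / eis_rho R n).

(* For [1 <= n] and [H < 2], [Eis n H] is empty and the quotient is [0]; this does
   not affect the limit inferior. *)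
Definition eis_ratio (R : realType) (n H : nat) : R :=
  (card_set (shiftedEis n H))%:R / (card_set (Eis n H))%:R.

(* Main.v *)
(** If [f] has height at most [h = H / 2^n], then [f(x+1)] has height at most [H],
   so every Eisenstein [f] of height at most [h] with [f(x+1)] not Eisenstein
   yields a shifted Eisenstein polynomial of height at most [H] that is not
   Eisenstein.  If [f]
   is Eisenstein at [p] then [f = a x^n] modulo [p], so [f(x+1)] has constant term
   [a <> 0] modulo [p] and can only be Eisenstein at some other prime [q].
   By the Chinese remainder theorem the pairs
   [(p, q)] account for a proportion at most [sum_(p <> q) d_p d_q = tau], where
   [d_p] is the local density, whereas the Eisenstein polynomials have
   proportion [rho].  Hence at least about [(rho - tau) (2h)^(n+1)] polynomials
   are gained against [rho (2H)^(n+1)] Eisenstein ones.  Only primes below a fixed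
   [N] are treated through periodicity; the contribution of the others is
   [O(H^(n+1) / N)] uniformly in [H]. *)

Require Import Defs.
From mathcomp Require Import all_boot all_order all_algebra finmap.
From mathcomp Require Import all_classical all_reals all_analysis.
From mathcomp Require Import zify ring lra.

Import numFieldNormedType.Exports.
Import Order.TTheory GRing.Theory Num.Theory.

Set Implicit Arguments.
Unset Strict Implicit.
Unset Printing Implicit Defensive.

Local Open Scope ring_scope.

(** * Counting polynomials in boxes *)

(** Offsets in a finite function type make every count a cardinal of a finite set. Height at most
    [H] is the case [c = -H], [L = 2H+1]; top coefficients may vanish. *)
Definition box_poly (k : nat) (c : int) (L : nat) (u : {ffun 'I_k -> 'I_L}) :
  {poly int} := rVpoly (\row_i (c + (u i : nat)%:Z)).

Definition in_box (k : nat) (c : int) (L : nat) (f : {poly int}) : bool :=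
  (size f <= k)%N && [forall i : 'I_k, c <= f`_i < c + L%:Z].

Definition cnt (k : nat) (c : int) (L : nat) (A : pred {poly int}) : nat :=
  #|[set u : {ffun 'I_k -> 'I_L} | A (box_poly c u)]|.

(** The coefficients in [[0, M)] form a complete residue system, so for an [M]-periodic [A] this
    counts residue classes. *)
Definition cnt_res (k M : nat) (A : pred {poly int}) : nat := cnt k 0 M A.

Definition periodic_mod (M : nat) (A : pred {poly int}) : Prop :=
  forall f g : {poly int}, (forall i, (M%:Z %| f`_i - g`_i)%Z) -> A f = A g.

Lemma coef_box_poly k c L (u : {ffun 'I_k -> 'I_L}) (i : 'I_k) :
  (box_poly c u)`_i = c + (u i : nat)%:Z.
Proof. by rewrite coef_rVpoly_ord mxE. Qed.

Lemma size_box_poly k c L (u : {ffun 'I_k -> 'I_L}) :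
  (size (box_poly c u) <= k)%N.
Proof. exact: size_poly. Qed.

Lemma box_poly_in_box k c L (u : {ffun 'I_k -> 'I_L}) :
  in_box k c L (box_poly c u).
Proof.
rewrite /in_box size_box_poly; apply/forallP => i.
by rewrite coef_box_poly; have := ltn_ord (u i); lia.
Qed.

Lemma box_polyK k c L (f : {poly int}) : in_box k c L f ->
  exists u : {ffun 'I_k -> 'I_L}, box_poly c u = f.
Proof.
case/andP => sf /forallP fP.
have ub i : (`|(f`_(i : 'I_k) - c)%R|%N < L)%N by have := fP i; lia.
exists [ffun i => Ordinal (ub i)]; apply/polyP => i.
case: (ltnP i k) => ik.
  have := coef_box_poly c [ffun i => Ordinal (ub i)] (Ordinal ik).
  by rewrite ffunE /= => ->; have := fP (Ordinal ik); rewrite /=; lia.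
by rewrite !nth_default // (leq_trans _ ik) // size_box_poly.
Qed.

Lemma box_poly_inj k c L : injective (@box_poly k c L).
Proof.
move=> u v uv; apply/ffunP => i; apply/val_inj.
have := congr1 (fun f : {poly int} => f`_i) uv.
by rewrite /= !coef_box_poly => /addrI [].
Qed.

(** The comparison tool for counts: [phi] will be the identity, the shift, or the shift followed by
    reduction modulo [M]. *)
Lemma cnt_le_inj k c L c' L' (A B : pred {poly int})
    (phi : {poly int} -> {poly int}) :
  {in in_box k c L &, injective phi} ->
  (forall f, in_box k c L f -> A f -> in_box k c' L' (phi f) && B (phi f)) ->
  (cnt k c L A <= cnt k c' L' B)%N.
Proof.
move=> phiI phiP; rewrite /cnt.
have ex u : A (@box_poly k c L u) ->
    exists v, @box_poly k c' L' v == phi (box_poly c u).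
  move=> Au; have /andP[/box_polyK[v <-] _] := phiP _ (box_poly_in_box c u) Au.
  by exists v.
(* [pick] inverts [box_poly] at the image; the option type avoids choosing a default index. *)
pose g (u : {ffun 'I_k -> 'I_L}) : option {ffun 'I_k -> 'I_L'} :=
  [pick v | @box_poly k c' L' v == phi (box_poly c u)].
set S := [set u | _]; set T := [set u | _].
have gI : {in S &, injective g}.
  move=> u v; rewrite !inE => Au Av; rewrite /g.
  case: pickP => [x /eqP xu|/(_ _)n]; last first.
    by have [w] := ex _ Au; rewrite n.
  case: pickP => [y /eqP yv [xy]|/(_ _)n]; last first.
    by have [w] := ex _ Av; rewrite n.
  by apply: (@box_poly_inj k c L); apply: phiI; rewrite -?xu -?yv ?xy //; apply: box_poly_in_box.
rewrite -(card_in_imset gI) -(@card_imset _ _ (@Some _) T); last by move=> x y [].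
apply: subset_leq_card; apply/fintype.subsetP => _ /imsetP[u uS ->].
rewrite inE in uS; rewrite /g; case: pickP => [x /eqP xu|/(_ _)n]; last first.
  by have [w] := ex _ uS; rewrite n.
apply/imsetP; exists x => //; rewrite inE xu.
by have /andP[] := phiP _ (box_poly_in_box c u) uS.
Qed.

Lemma cnt_le k c L (A B : pred {poly int}) :
  (forall f, in_box k c L f -> A f -> B f) -> (cnt k c L A <= cnt k c L B)%N.
Proof. by move=> AB; apply: (@cnt_le_inj _ _ _ _ _ _ _ id) => // f fb /AB ->; rewrite ?andbT. Qed.

Lemma eq_cnt k c L (A B : pred {poly int}) :
  (forall f, in_box k c L f -> A f = B f) -> cnt k c L A = cnt k c L B.
Proof.
by move=> AB; apply/eqP; rewrite eqn_leq; apply/andP; split;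
  apply: cnt_le => f /AB ->.
Qed.

Lemma cnt_setC k c L (A : pred {poly int}) :
  (cnt k c L A + cnt k c L (predC A) = L ^ k)%N.
Proof.
rewrite /cnt; have -> : (L ^ k)%N = #|{ffun 'I_k -> 'I_L}| by rewrite card_ffun !card_ord.
rewrite -(cardsC [set u | A (@box_poly k c L u)]); congr addn.
by apply: eq_card => u; rewrite !inE.
Qed.

Lemma cnt_predU k c L (A B : pred {poly int}) :
  (cnt k c L (predU A B) <= cnt k c L A + cnt k c L B)%N.
Proof.
apply: leq_trans (leq_card_setU _ _); apply: subset_leq_card.
by apply/fintype.subsetP => u; rewrite !inE.
Qed.

Lemma cnt_has k c L (I : Type) (s : seq I) (A : I -> pred {poly int}) :
  (cnt k c L (fun f => has (fun i => A i f) s) <= \sum_(i <- s) cnt k c L (A i))%N.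
Proof.
elim: s => [|i s IH]; rewrite ?big_nil ?big_cons.
  by rewrite leqn0 cards_eq0; apply/eqP/setP => u; rewrite !inE.
by apply: leq_trans (cnt_predU _ _ _ _ _) _; rewrite leq_add2l.
Qed.

(** * Residue classes in intervals and periodic conditions *)

Definition res_count (c : int) (L M r : nat) : nat :=
  #|[set u : 'I_L | (M%:Z %| c + (u : nat)%:Z - r%:Z)%Z]|.

Lemma res_count_bounds c L M r : (0 < M)%N ->
  (L %/ M <= res_count c L M r <= (L %/ M).+1)%N.
Proof.
(* The congruence on [u] says that [u] has remainder [r'] modulo [M]. *)
move=> M0; pose r' := `|((r%:Z - c) %% M%:Z)%Z|%N.
have r'E : r'%:Z = ((r%:Z - c) %% M%:Z)%Z by rewrite gez0_abs // modz_ge0; lia.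
have r'M : (r' < M)%N by have := @ltz_pmod (r%:Z - c) M%:Z; rewrite -r'E; lia.
have E (u : nat) : (M%:Z %| c + u%:Z - r%:Z)%Z = (u %% M == r')%N.
  have -> : c + u%:Z - r%:Z = u%:Z - (r%:Z - c) by ring.
  by rewrite -eqz_mod_dvd -r'E modz_nat.
rewrite /res_count; under eq_finset do rewrite E.
(* Upper bound: within one residue class, [u] is determined by its quotient by [M]. *)
apply/andP; split; last first.
  have lt (u : 'I_L) : (u %/ M < (L %/ M).+1)%N.
    by rewrite ltnS leq_div2r // ltnW.
  rewrite -[X in (_ <= X)%N]card_ord -(@card_in_imset _ _ (fun u : 'I_L => Ordinal (lt u))).
    exact: max_card.
  move=> u v; rewrite !inE => /eqP ur /eqP vr [] uv.
  by apply/val_inj; rewrite /= (divn_eq u M) (divn_eq v M) ur vr uv.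
(* Lower bound: the numbers [t * M + r'] are distinct solutions below [L]. *)
have lt (t : 'I_(L %/ M)) : (t * M + r' < L)%N.
  have : (t.+1 * M <= L)%N.
    by apply: leq_trans (leq_divM L M); rewrite leq_mul2r ltn_ord orbT.
  by apply: leq_trans; rewrite mulSn addnC ltn_add2r.
rewrite -[X in (X <= _)%N]card_ord.
rewrite -(@card_imset _ _ (fun u : 'I_(L %/ M) => Ordinal (lt u))).
  apply: subset_leq_card; apply/fintype.subsetP => _ /imsetP[t _ ->].
  by rewrite inE /= modnMDl modn_small.
move=> t s [] /eqP; rewrite eqn_add2r eqn_mul2r.
by rewrite eqn0Ngt M0 /= => /eqP ts; apply/val_inj.
Qed.

(** Polynomials are grouped by their reduction modulo [M]; within a fibre the coefficients vary
    independently, whence the product. *)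
Lemma cnt_periodic k c L M (A : pred {poly int}) : (0 < M)%N -> periodic_mod M A ->
  cnt k c L A = (\sum_(v : {ffun 'I_k -> 'I_M} | A (box_poly 0 v))
                  \prod_i res_count c L M (v i))%N.
Proof.
move=> M0 pA.
have lt (u : {ffun 'I_k -> 'I_L}) i : (`|((c + (u i : nat)%:Z) %% M%:Z)%Z|%N < M)%N.
  by have := @ltz_pmod (c + (u i : nat)%:Z) M%:Z; have := @modz_ge0 (c + (u i : nat)%:Z) M%:Z; lia.
pose red u : {ffun 'I_k -> 'I_M} := [ffun i => Ordinal (lt u i)].
have redE u v : (red u == v) = [forall i, (M%:Z %| c + (u i : nat)%:Z - (v i : nat)%:Z)%Z].
  apply/eqP/forallP => [<- i|h].
    rewrite ffunE /= -eqz_mod_dvd gez0_abs ?modz_mod // modz_ge0; lia.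
  apply/ffunP => i; rewrite ffunE; apply/val_inj => /=.
  have := h i; rewrite -eqz_mod_dvd => /eqP ->.
  by rewrite modz_nat modn_small.
have redA u : A (@box_poly k c L u) = A (box_poly 0 (red u)).
  apply: pA => i; case: (ltnP i k) => ik; last first.
    by rewrite !nth_default ?(leq_trans _ ik) ?size_box_poly // subr0 dvdz0.
  have := coef_box_poly c u (Ordinal ik); rewrite /= => ->.
  have := coef_box_poly 0 (red u) (Ordinal ik); rewrite /= add0r => ->.
  by have := eqxx (red u); rewrite redE => /forallP.
rewrite /cnt -sum1_card (eq_bigl (fun u => A (@box_poly k c L u))); last by move=> u; rewrite inE.
rewrite (partition_big red (fun v => A (box_poly 0 v))) /=; last by move=> u; rewrite redA.
apply: eq_bigr => v Av.
transitivity (\sum_(u | red u == v) 1)%N.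
  by apply: eq_bigl => u; rewrite redA; case: eqP => [->|]; rewrite ?Av ?andbF.
under [RHS]eq_bigr do rewrite /res_count -sum1_card.
rewrite bigA_distr_big_dep; apply: eq_big => [u|u _]; last by rewrite big1.
by rewrite redE; apply/forallP/familyP => h i; have := h i; rewrite inE.
Qed.

Lemma cnt_bounds k c L M A : (0 < M)%N -> periodic_mod M A ->
  (cnt_res k M A * (L %/ M) ^ k <= cnt k c L A <= cnt_res k M A * (L %/ M).+1 ^ k)%N.
Proof.
move=> M0 pA; rewrite (cnt_periodic _ _ _ M0 pA) /cnt_res /cnt.
have cE m : (#|[set v | A (@box_poly k 0 M v)]| * m ^ k =
    \sum_(v | A (@box_poly k 0 M v)) \prod_(i < k) m)%N.
  rewrite -sum_nat_const; apply: eq_big => [v|v _]; first by rewrite inE.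
  by rewrite prod_nat_const card_ord.
by rewrite !cE; apply/andP; split; apply: leq_sum => v _; apply: leq_prod => i _;
  have /andP[] := res_count_bounds c L (v i) M0.
Qed.

(** Independence of conditions with coprime periods: the Chinese remainder theorem, applied to each
    coefficient, makes [r] a bijection. *)
Lemma cnt_coprime k M1 M2 (A B : pred {poly int}) :
  (0 < M1)%N -> (0 < M2)%N -> coprime M1 M2 -> periodic_mod M1 A -> periodic_mod M2 B ->
  cnt_res k (M1 * M2) (predI A B) = (cnt_res k M1 A * cnt_res k M2 B)%N.
Proof.
move=> M10 M20 co pA pB.
pose r1 (u : {ffun 'I_k -> 'I_(M1 * M2)}) : {ffun 'I_k -> 'I_M1} :=
  [ffun i => Ordinal (ltn_pmod (u i) M10)].
pose r2 (u : {ffun 'I_k -> 'I_(M1 * M2)}) : {ffun 'I_k -> 'I_M2} :=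
  [ffun i => Ordinal (ltn_pmod (u i) M20)].
have rA u : A (box_poly 0 u) = A (box_poly 0 (r1 u)).
  apply: pA => i; case: (ltnP i k) => ik; last first.
    by rewrite !nth_default ?(leq_trans _ ik) ?size_box_poly // subr0 dvdz0.
  have := coef_box_poly 0 u (Ordinal ik); rewrite /= => ->.
  have := coef_box_poly 0 (r1 u) (Ordinal ik); rewrite /= !add0r => ->.
  by rewrite ffunE /= -eqz_mod_dvd !modz_nat modn_mod.
have rB u : B (box_poly 0 u) = B (box_poly 0 (r2 u)).
  apply: pB => i; case: (ltnP i k) => ik; last first.
    by rewrite !nth_default ?(leq_trans _ ik) ?size_box_poly // subr0 dvdz0.
  have := coef_box_poly 0 u (Ordinal ik); rewrite /= => ->.
  have := coef_box_poly 0 (r2 u) (Ordinal ik); rewrite /= !add0r => ->.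
  by rewrite ffunE /= -eqz_mod_dvd !modz_nat modn_mod.
pose r u := (r1 u, r2 u).
have rI : injective r.
  move=> u v [] /ffunP e1 /ffunP e2; apply/ffunP => i; apply/val_inj => /=.
  have := e1 i; rewrite !ffunE => -[] /eqP m1.
  have := e2 i; rewrite !ffunE => -[] /eqP m2.
  have : (u i == v i %[mod M1 * M2])%N by rewrite chinese_remainder // m1 m2.
  by rewrite !modn_small // => /eqP.
have rbij : bijective r.
  by apply: inj_card_bij => //; rewrite card_prod !card_ffun !card_ord expnMn.
rewrite /cnt_res /cnt -cardsX -(on_card_preimset (f := r)); last exact: onW_bij.
by apply: eq_card => u; rewrite !inE rA rB.
Qed.

(** * The Eisenstein condition and the shift by one *)

(* On polynomials of size at most [n.+1], the condition at index [n] forces the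
   degree to be exactly [n]. *)
Definition eis (n p : nat) : pred {poly int} := fun f =>
  [&& [forall i : 'I_n, (p%:Z %| f`_i)%Z], ~~ ((p ^ 2)%N%:Z %| f`_0)%Z
    & ~~ (p%:Z %| f`_n)%Z].

Definition eis_in (n : nat) (s : seq nat) : pred {poly int} := fun f =>
  has (fun p => prime p && eis n p f) s.
Arguments eis_in : simpl never.

Definition shift1 (f : {poly int}) : {poly int} := f \Po ('X + 1%:P).

Lemma eisP n p (f : {poly int}) : (size f <= n.+1)%N ->
  reflect (size f = n.+1 /\ eisenstein_at p f) (eis n p f).
Proof.
move=> sf; apply: (iffP and3P) => [[/forallP h1 h2 h3]|[s [h1 h2 h3]]].
  have s : size f = n.+1.
    apply/eqP; rewrite eqn_leq sf ltnNge; apply: contra h3 => sn.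
    by rewrite nth_default // dvdz0.
  split=> //; split => // [i|]; last by rewrite lead_coefE s.
  by rewrite s => ii; have := h1 (Ordinal ii).
split=> //; last by rewrite lead_coefE s in h3.
by apply/forallP => i; apply: h1; rewrite s ltn_ord.
Qed.

Lemma periodic_dvd (M d : nat) i : (d %| M)%N ->
  periodic_mod M (fun f => (d%:Z %| f`_i)%Z).
Proof.
move=> dM f g /(_ i) h; have {}h : (d%:Z %| f`_i - g`_i)%Z.
  by apply: dvdz_trans h; rewrite dvdzE /=.
by rewrite -[f`_i](subrK g`_i) rpredDl.
Qed.

Lemma eis_periodic n p : periodic_mod (p ^ 2) (eis n p).
Proof.
move=> f g fg; rewrite /eis.
have pp : (p %| p ^ 2)%N by rewrite dvdn_exp.
rewrite (periodic_dvd _ pp fg) (periodic_dvd _ (dvdnn _) fg); congr (_ && _).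
by apply: eq_forallb => i; rewrite (periodic_dvd _ pp fg).
Qed.

Lemma periodic_dvdn M M' A : (M %| M')%N -> periodic_mod M A -> periodic_mod M' A.
Proof.
move=> MM pA f g fg; apply: pA => i; apply: dvdz_trans (fg i).
by rewrite dvdzE.
Qed.

(** If [f - g = M q], then the shifts differ by [M] times the shift of [q]. *)
Lemma shift1_periodic M A : periodic_mod M A -> periodic_mod M (A \o shift1).
Proof.
move=> pA f g fg; apply: pA.
have /polyOver_dvdzP[q fgE] : f - g \is a polyOver (dvdz M%:Z).
  by apply/polyOverP => i; rewrite coefB; apply: fg.
move=> i; rewrite -coefB /shift1 -[f \Po _ - _]rmorphB /= fgE.
by rewrite linearZ /= coefZ dvdz_mulr.
Qed.

Lemma size_shift1 (f : {poly int}) : size (shift1 f) = size f.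
Proof. by rewrite size_comp_poly2 // size_XaddC. Qed.

Lemma shift1K f : shift1 f \Po ('X + (-1)%:P) = f.
Proof. by rewrite polyCN comp_polyXaddC_K. Qed.

Lemma shift1_inj : injective shift1.
Proof. by apply: (can_inj (g := fun f => f \Po ('X + (-1)%:P))); apply: shift1K. Qed.

(* The shift is injective modulo [M] since composition with [X - 1] undoes it. *)
Lemma cnt_shift1_residues k M A : (0 < M)%N -> periodic_mod M A ->
  (cnt_res k M (A \o shift1) <= cnt_res k M A)%N.
Proof.
move=> M0 pA.
(* The shift leaves the box [[0, M)], so its coefficients are reduced back into it. *)
pose phi f := \poly_(i < k) ((shift1 f)`_i %% M%:Z)%Z.
have phiE f i : in_box k 0 M f -> (M%:Z %| (phi f)`_i - (shift1 f)`_i)%Z.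
  case/andP => sf _; rewrite coef_poly; case: ltnP => ik.
    by rewrite -eqz_mod_dvd modz_mod.
  by rewrite nth_default ?subr0 ?dvdz0 // size_shift1 (leq_trans sf).
rewrite /cnt_res; apply: (@cnt_le_inj _ _ _ _ _ _ _ phi) => [f g fb gb fg|f fb /= Af]; last first.
  rewrite -(pA _ _ (phiE f ^~ fb)) in Af; rewrite Af andbT /in_box size_poly.
  apply/forallP => i; rewrite coef_poly ltn_ord.
  by have := @ltz_pmod (shift1 f)`_i M%:Z; have := @modz_ge0 (shift1 f)`_i M%:Z; lia.
have h i : (M%:Z %| (f - g)`_i)%Z.
  have /polyOver_dvdzP[q e] : shift1 f - shift1 g \is a polyOver (dvdz M%:Z).
    apply/polyOverP => j; rewrite coefB.
    rewrite -[X in X \in _](subrKA (phi g)`_j) rpredDl ?phiE //.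
    by rewrite -rpredN opprB -fg phiE.
  have -> : f - g = (shift1 f - shift1 g) \Po ('X + (-1)%:P).
    by rewrite rmorphB /= !shift1K.
  rewrite e.
  by rewrite linearZ /= coefZ dvdz_mulr.
(* [f] and [g] are now congruent modulo [M], and both have coefficients in [[0, M)]. *)
apply/polyP => i; case: (ltnP i k) => ik; last first.
  by case/andP: fb => sf _; case/andP: gb => sg _; rewrite !nth_default ?(leq_trans _ ik).
case/andP: fb => _ /forallP/(_ (Ordinal ik)) /=; case/andP: gb => _ /forallP/(_ (Ordinal ik)) /=.
rewrite !add0r => /andP[g0 gM] /andP[f0 fM].
have := h i; rewrite coefB -eqz_mod_dvd => /eqP.
by rewrite !modz_small ?f0 ?g0.
Qed.

Lemma coef_Xadd1_exp j i : (('X + 1%:P : {poly int}) ^+ j)`_i = 'C(j, i)%:Z.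
Proof.
elim: j i => [|j IH] i; first by rewrite expr0 coef1; case: i.
rewrite exprSr mulrDr mulr1 coefD coefMX IH.
case: i => [|i] /=; first by rewrite add0r IH !bin0.
by rewrite IH binS PoszD addrC.
Qed.

Lemma bin_le_expn2 m i : ('C(m.+1, i) <= 2 ^ m)%N.
Proof.
elim: m i => [|m IH] [|i]; rewrite ?bin0 ?expn_gt0 //.
  by case: i => [|[]].
by rewrite binS expnS mul2n -addnn leq_add.
Qed.

(** Row 0 contributes at most 1 and row [j > 0] at most [2^(j-1)]. The total [2^n] is the growth of
    the height under the shift, whose power [n+1] is the denominator in [eis_gamma]. *)
Lemma sum_bin_le_expn2 n i : (\sum_(j < n.+1) 'C(j, i) <= 2 ^ n)%N.
Proof.
elim: n => [|n IH]; first by rewrite big_ord1; case: i.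
by rewrite big_ord_recr /= expnS mul2n -addnn leq_add // bin_le_expn2.
Qed.

Lemma shift1_in_box n h f : in_box n.+1 (- h%:Z) (2 * h).+1 f ->
  in_box n.+1 (- (2 ^ n * h)%N%:Z) (2 * (2 ^ n * h)).+1 (shift1 f).
Proof.
case/andP => sf /forallP fP; rewrite /in_box size_shift1 sf; apply/forallP => i.
suff : `|(shift1 f)`_i| <= (2 ^ n * h)%N%:Z by lia.
(* The binomial expansion of [(X+1)^j]; coefficients beyond the size of [f] are zero, so the sum may
   run up to [n]. *)
have -> : (shift1 f)`_i = \sum_(j < n.+1) f`_j * 'C(j, i)%:Z.
  rewrite coef_comp_poly (big_ord_widen _ (fun j => f`_j * (('X + 1%:P) ^+ j)`_i) sf).
  rewrite big_mkcond; apply: eq_bigr => j _.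
  by case: ltnP => jf; rewrite ?coef_Xadd1_exp // nth_default // mul0r.
apply: le_trans (ler_norm_sum _ _ _) _.
apply: (@le_trans _ _ (\sum_(j < n.+1) h%:Z * 'C(j, i)%:Z)).
  apply: ler_sum => j _; rewrite normrM ler_pM //; have := fP j; lia.
rewrite -mulr_sumr -(big_morph Posz PoszD (erefl _)) -PoszM lez_nat mulnC.
by rewrite leq_mul2r sum_bin_le_expn2 orbT.
Qed.

Lemma eis_shift1_disjoint n p (f : {poly int}) : (0 < n)%N -> (size f <= n.+1)%N ->
  eis n p f -> ~~ eis n p (shift1 f).
Proof.
move=> n0 sf /and3P[/forallP h1 _ h3]; apply/and3P => -[/forallP/(_ (Ordinal n0)) /= h _ _].
(* The constant term of the shift is [f(1)], the sum of the coefficients, congruent to the leading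
   one modulo [p]. *)
move: h; rewrite -horner_coef0 horner_comp !hornerE (horner_coef_wide _ sf).
rewrite big_ord_recr /= expr1n mulr1 rpredDl ?(negPf h3) //.
by apply: rpred_sum => i _; rewrite expr1n mulr1; apply: h1.
Qed.

(** * Counting the Eisenstein condition modulo [p^2] and in an interval *)

Lemma cnt_forall k (c : int) L (Q : 'I_k -> pred int) :
  cnt k c L (fun f => [forall i : 'I_k, Q i f`_i]) =
  (\prod_i #|[set x : 'I_L | Q i (c + (x : nat)%:Z)%R]|)%N.
Proof.
under [RHS]eq_bigr do rewrite -sum1_card.
rewrite bigA_distr_big_dep /cnt -sum1_card.
apply: eq_big => [u|u _]; last by rewrite big1.
rewrite inE; apply/forallP/familyP => h i; have := h i;
  by rewrite inE coef_box_poly.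
Qed.

Lemma card_ord_pred L (P : pred nat) :
  #|[set x : 'I_L | P x]| = (\sum_(0 <= x < L | P x) 1)%N.
Proof. by rewrite -sum1_card big_mkord; apply: eq_bigl => x; rewrite inE. Qed.

Lemma sum_dvdn_sqr p : (0 < p)%N -> (\sum_(1 <= x < p ^ 2 | p %| x) 1 = p.-1)%N.
Proof.
case: p => // p _; have -> : (p.+1 ^ 2 = (p.+1 ^ 2).-1.+1)%N by rewrite prednK // expn_gt0.
rewrite big_mkcond -[RHS](_ : ((p.+1 ^ 2).-1 %/ p.+1 = p))%N; last first.
  have -> : ((p.+1 ^ 2).-1 = p * p.+1 + p)%N by lia.
  by rewrite divnMDl // divn_small // addn0.
rewrite divn_count_dvd; apply: eq_bigr => i _; by case: dvdn.
Qed.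

(** Modulo [p^2] there are [p-1] choices for the constant coefficient, [p] for each of the [n-1]
    middle ones and [p(p-1)] for the leading one. *)
Lemma cnt_eis_residues n p : (0 < n)%N -> (0 < p)%N ->
  cnt_res n.+1 (p ^ 2) (eis n p) = (p.-1 ^ 2 * p ^ n)%N.
Proof.
case: n => // m _ p0.
pose Q (i : 'I_m.+2) (x : int) :=
  [&& (i < m.+1)%N ==> (p%:Z %| x)%Z, (i == 0 :> nat) ==> ~~ ((p ^ 2)%N%:Z %| x)%Z
    & (i == m.+1 :> nat) ==> ~~ (p%:Z %| x)%Z].
rewrite /cnt_res (eq_cnt (B := fun f => [forall i : 'I_m.+2, Q i f`_i])); last first.
  move=> f _; apply/and3P/forallP => [[/forallP h1 h2 h3] i|h].
    apply/and3P; split; apply/implyP; [move=> ii|by move=> /eqP->|by move=> /eqP->].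
    exact: (h1 (Ordinal ii)).
  split.
  - apply/forallP => i; have /and3P[/implyP + _ _] := h (widen_ord (leqnSn _) i).
    by apply; rewrite /= ltn_ord.
  - by have /and3P[_ /implyP + _] := h ord0; apply.
  - by have /and3P[_ _ /implyP] := h ord_max; apply; rewrite /=.
have p2 : (0 < p ^ 2)%N by rewrite expn_gt0 p0.
rewrite cnt_forall big_ord_recr big_ord_recl /=.
have -> : #|[set x : 'I_(p ^ 2) | Q (widen_ord (leqnSn m.+1) ord0) (0 + (x : nat)%:Z)]| = p.-1.
  rewrite (eq_card (B := [set x : 'I_(p ^ 2) | (p %| x) && ~~ (p ^ 2 %| x)]%N)); last first.
    by move=> x; rewrite !inE /Q /= add0r !dvdzE /= andbT.
  rewrite (card_ord_pred _ (fun x => (p %| x) && ~~ (p ^ 2 %| x))%N).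
  rewrite -[RHS]sum_dvdn_sqr // big_ltn_cond // !dvdn0 /=.
  rewrite big_nat_cond [RHS]big_nat_cond; apply: eq_bigl => x.
  case: (ltnP x (p ^ 2)) => xp; rewrite ?andbF //.
  by case: x xp => [|x] xp; rewrite ?andbF //= [(p ^ 2 %| _)%N]gtnNdvd ?andbT.
have -> : #|[set x : 'I_(p ^ 2) | Q ord_max (0 + (x : nat)%:Z)]| = (p * p.-1)%N.
  rewrite (eq_card (B := ~: [set x : 'I_(p ^ 2) | (p %| x)]%N)); last first.
    by move=> x; rewrite !inE /Q /= ltnn eqxx /= add0r dvdzE.
  have := cardsC [set x : 'I_(p ^ 2) | (p %| x)%N].
  rewrite card_ord (card_ord_pred _ (dvdn p)) big_ltn_cond // dvdn0 sum_dvdn_sqr //.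
  case: p p0 p2 Q => // q _ _ _ /=; move: #|_| => z; nia.
rewrite (eq_bigr (fun=> p)); last first.
  move=> i _; rewrite (eq_card (B := [set x : 'I_(p ^ 2) | (p %| x)]%N)); last first.
    move=> x; rewrite !inE /Q /= add0r dvdzE /= /bump /= add1n ltnS ltn_ord /=.
    by rewrite eqSS ltn_eqF ?andbT // ltn_ord.
  rewrite (card_ord_pred _ (dvdn p)) big_ltn_cond // dvdn0 sum_dvdn_sqr //.
  by rewrite add1n prednK.
by rewrite prod_nat_const card_ord (expnS p m) -mulnn; move: (p ^ m)%N p.-1 => a b; lia.
Qed.

(** Used for large primes, where [p^2] may exceed [L]. Only divisibility of the [n] lower
    coefficients is kept: each has at most [L/p + 1 <= 2L/p] values. *)
Lemma cnt_eis_le n p c L : (0 < p <= L)%N ->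
  (cnt n.+1 c L (eis n p) * p ^ n <= 2 ^ n * L ^ n.+1)%N.
Proof.
case/andP => p0 pL.
pose Q (i : 'I_n.+1) (x : int) := (i < n)%N ==> (p%:Z %| x)%Z.
have : (cnt n.+1 c L (eis n p) <= cnt n.+1 c L (fun f => [forall i : 'I_n.+1, Q i f`_i]%R))%N.
  apply: cnt_le => f _ /and3P[/forallP h _ _]; apply/forallP => i.
  by apply/implyP => ii; exact: (h (Ordinal ii)).
rewrite cnt_forall big_ord_recr /= => h.
apply: (@leq_trans (res_count c L p 0 ^ n * L * p ^ n)).
  rewrite leq_mul2r; apply/orP; right; apply: leq_trans h _; apply: leq_mul; last first.
    by rewrite -[X in (_ <= X)%N]card_ord max_card.
  rewrite (eq_bigr (fun=> res_count c L p 0)); first by rewrite prod_nat_const card_ord.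
  move=> i _; apply: eq_card => x; rewrite !inE /Q /= ltn_ord /=.
  by rewrite subr0.
rewrite mulnAC -expnMn (expnS L) (mulnC L) mulnA -(expnMn 2) leq_mul2r; apply/orP; right.
have /andP[_ ub] := res_count_bounds c L 0 p0.
have {}ub : (res_count c L p 0 * p <= 2 * L)%N.
  apply: (@leq_trans ((L %/ p).+1 * p)); first by rewrite leq_mul2r ub orbT.
  by rewrite mulSn mul2n -addnn leq_add // leq_divM.
by case: n {Q h} => // n; rewrite leq_exp2r.
Qed.

(** * From sets of polynomials to counts *)

Definition cnt_height n H A := cnt n.+1 (- H%:Z) (2 * H).+1 A.

Lemma bounded_polyE n H f :
  bounded_poly n H f <-> in_box n.+1 (- H%:Z) (2 * H).+1 f /\ size f = n.+1.
Proof.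
rewrite /bounded_poly /in_box /=; split => [[sf hf]|[/andP[_ /forallP fP] sf]].
  split=> //; rewrite sf leqnn; apply/forallP => i.
  have li : (i < size f)%N by rewrite sf.
  have := leq_trans (leq_bigmax (Ordinal li) (F := fun j : 'I_(size f) => `|(f`_j)%R|%N)) hf.
  by rewrite /=; lia.
split=> //; apply/bigmax_leqP => i _.
have li : (i < n.+1)%N by rewrite -sf.
by have := fP (Ordinal li); rewrite /=; lia.
Qed.

(** Boxes also contain polynomials of smaller degree, so the exact degree becomes part of the
    counted predicate. *)
Lemma card_set_bounded n H (P : {poly int} -> Prop) :
  card_set [set f | bounded_poly n H f /\ P f]%classic =
  cnt_height n H (fun f => (size f == n.+1) && `[< P f >]).
Proof.
rewrite /card_set /cnt_height /cnt; set T := [set u | _].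
have fin : finite_set [set f | bounded_poly n H f /\ P f]%classic.
  by apply: sub_finite_set (finite_bounded_poly n H) => f [].
have -> : fset_set [set f | bounded_poly n H f /\ P f]%classic =
    [fset @box_poly n.+1 (- H%:Z) (2 * H).+1 u | u in T]%fset.
  apply/fsetP => f; rewrite in_fset_set //; apply/idP/imfsetP => [|[u uT ->]].
    rewrite inE /= => -[/bounded_polyE[/box_polyK[u <-] sf] Pf].
    by exists u => //; rewrite /= inE sf eqxx /=; apply/asboolP.
  rewrite /= inE in uT; case/andP: uT => /eqP s /asboolP Pu.
  by rewrite inE /=; split=> //; apply/bounded_polyE; split=> //; apply: box_poly_in_box.
by rewrite card_imfset; [rewrite cardE|apply: box_poly_inj].
Qed.

(** The constant coefficient is a multiple of [p], nonzero since [p^2] does not divide it, so [p] is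
    at most its absolute value. *)
Lemma eis_height n p H f : prime p -> in_box n.+1 (- H%:Z) (2 * H).+1 f ->
  (0 < n)%N -> eis n p f -> (p <= H)%N.
Proof.
move=> pp /andP[_ /forallP/(_ ord0) /= fb] n0 /and3P[/forallP/(_ (Ordinal n0)) /= pf p2 _].
have f0 : f`_0 != 0 by apply: contra p2 => /eqP ->; apply: dvdz0.
rewrite dvdzE /= in pf; have /dvdn_leq := pf; rewrite absz_gt0 => /(_ f0).
by move=> h; apply: leq_trans h _; lia.
Qed.

Lemma eis_in_eisenstein n H f : (0 < n)%N -> in_box n.+1 (- H%:Z) (2 * H).+1 f ->
  eis_in n (index_iota 0 H.+1) f = (size f == n.+1) && `[< eisenstein f >].
Proof.
move=> n0 fb; have sf : (size f <= n.+1)%N by case/andP: fb.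
apply/hasP/andP => [[p _ /andP[pp /(eisP p sf)[s e]]]|[/eqP s /asboolP[p pp e]]].
  by rewrite s eqxx; split=> //; apply/asboolP; exists p.
have ep : eis n p f by apply/eisP.
exists p; last by rewrite pp.
by rewrite mem_index_iota /= ltnS (eis_height pp fb).
Qed.

Lemma card_EisE n H : (0 < n)%N ->
  card_set (Eis n H) = cnt_height n H (eis_in n (index_iota 0 H.+1)).
Proof.
move=> n0; rewrite card_set_bounded; apply: eq_cnt => f fb.
by rewrite eis_in_eisenstein.
Qed.

Lemma shift1_in_box_le n h H f : (2 ^ n * h <= H)%N ->
  in_box n.+1 (- h%:Z) (2 * h).+1 f ->
  in_box n.+1 (- H%:Z) (2 * H).+1 (shift1 f).
Proof.
move=> hH /shift1_in_box /andP[sf /forallP fP]; rewrite /in_box sf.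
by apply/forallP => i; have := fP i; lia.
Qed.

(* For a polynomial of height at most [H] only primes up to [H] can be Eisenstein
   primes, see [eis_height]; this keeps the condition a finite one. *)
Definition shift_gain n H : pred {poly int} := fun f =>
  eis_in n (index_iota 0 H.+1) f && ~~ eis_in n (index_iota 0 H.+1) (shift1 f).

(** The Eisenstein polynomials and the shifts of those counted by [shift_gain] form disjoint
    families of shifted Eisenstein polynomials. *)
Lemma shiftedEis_gain n h H : (0 < n)%N -> (2 ^ n * h <= H)%N ->
  (card_set (Eis n H) + cnt_height n h (shift_gain n H) <= card_set (shiftedEis n H))%N.
Proof.
move=> n0 hH; rewrite [X in (_ <= X)%N]card_set_bounded card_EisE //.
set S := (fun f => _ && _); set E := eis_in n (index_iota 0 H.+1).
have : (cnt_height n H E + cnt_height n H (predI S (predC E)) <= cnt_height n H S)%N.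
  rewrite /cnt_height /cnt -cardsUI [X in (_ + X)%N](_ : _ = 0)%N; last first.
    apply/eqP; rewrite cards_eq0; apply/eqP/setP => u; rewrite !inE /=.
    by case: (E _); rewrite ?andbF.
  rewrite addn0; apply: subset_leq_card; apply/fintype.subsetP => u; rewrite !inE.
  case/orP => [|/andP[]//].
  rewrite /E eis_in_eisenstein ?box_poly_in_box // => /andP[/eqP s /asboolP e].
  by rewrite /S s eqxx /=; apply/asboolP; exists 0; rewrite addr0 comp_polyXr.
apply: leq_trans; rewrite leq_add2l; apply: (cnt_le_inj (phi := shift1)).
  by move=> f g _ _; apply: shift1_inj.
move=> f fb /andP[fe fs]; rewrite (shift1_in_box_le hH fb) /= fs andbT /S.
have sf : (size f <= n.+1)%N by case/andP: fb.
case/hasP: fe => p _ /andP[pp /(eisP p sf)[s e]].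
(* The shift by [-1] recovers the Eisenstein polynomial [f]. *)
rewrite size_shift1 s eqxx /=; apply/asboolP; exists (-1).
by rewrite shift1K; exists p.
Qed.

Definition eis_pair n p q : pred {poly int} := predI (eis n p) (eis n q \o shift1).

(** Each polynomial of height at most [h] is gained, or is Eisenstein at no prime below [N], or
    forms a pair [p], [q] below [N], or has a shift Eisenstein at some prime [q >= N]. The additive
    form avoids truncated subtraction. *)
Lemma cnt_gain_lower n h H N : (0 < n)%N -> (2 ^ n * h <= H)%N ->
  ((2 * h).+1 ^ n.+1 <=
   cnt_height n h (shift_gain n H)
   + cnt_height n h (predC (eis_in n (index_iota 0 N)))
   + \sum_(0 <= p < N | prime p) \sum_(0 <= q < N | prime q && (q != p))
       cnt_height n h (eis_pair n p q)
   + cnt_height n H (eis_in n (index_iota N H.+1)))%N.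
Proof.
move=> n0 hH.
pose P f := has (fun p => has (fun q => eis_pair n p q f)
  [seq q <- index_iota 0 N | prime q && (q != p)]) [seq p <- index_iota 0 N | prime p].
pose T := eis_in n (index_iota N H.+1) \o shift1.
apply: (@leq_trans (cnt_height n h (predU (predU (predU (shift_gain n H)
   (predC (eis_in n (index_iota 0 N)))) P) T))).
  rewrite /cnt_height -(cnt_setC n.+1 (- h%:Z) _ predT).
  rewrite [X in (_ + X <= _)%N](_ : _ = 0)%N ?addn0; last first.
    by apply/eqP; rewrite cards_eq0; apply/eqP/setP => u; rewrite !inE.
  apply: cnt_le => f fb _ /=.
  case: (boolP (eis_in n (index_iota 0 N) f)) => [fN|]; last by rewrite /= orbT.
  have fH : eis_in n (index_iota 0 H.+1) f.
    case/hasP: fN => p _ /andP[pp e]; apply/hasP; exists p; last by rewrite pp.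
    rewrite mem_index_iota /= ltnS; apply: leq_trans (eis_height pp fb n0 e) _.
    by apply: leq_trans hH; rewrite leq_pmull // expn_gt0.
  rewrite /shift_gain fH orbF /=.
  case: (boolP (eis_in n (index_iota 0 H.+1) (shift1 f))) => //= /hasP[q].
  rewrite mem_index_iota /= => qH /andP[pq eq].
  case: (ltnP q N) => qN; last first.
    by apply/orP; right; apply/hasP; exists q; rewrite ?mem_index_iota ?qN // pq.
  apply/orP; left; case/hasP: fN => p pN /andP[pp ep].
  apply/hasP; exists p; first by rewrite mem_filter pp.
  apply/hasP; exists q; last by rewrite /eis_pair /= ep.
  (* The two primes differ, since the shift cannot be Eisenstein at [p] again. *)
  rewrite mem_filter pq mem_index_iota /= qN andbT; apply: contraL eq => /eqP ->.
  by apply: eis_shift1_disjoint => //; case/andP: fb.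
apply: leq_trans (cnt_predU _ _ _ _ _) _; apply: leq_add; last first.
  (* The last class is counted after shifting, hence in the larger box of height [H]. *)
  apply: (cnt_le_inj (phi := shift1)) => [f g _ _|f fb Tf]; first exact: shift1_inj.
  by rewrite (shift1_in_box_le hH fb).
apply: leq_trans (cnt_predU _ _ _ _ _) _; apply: leq_add; last first.
  apply: leq_trans (cnt_has _ _ _ _ _) _; rewrite big_filter.
  apply: leq_sum => p _; rewrite -big_filter; exact: cnt_has.
exact: cnt_predU.
Qed.

Lemma cnt_Eis_upper n H N :
  (cnt_height n H (eis_in n (index_iota 0 H.+1)) +
   cnt_height n H (predC (eis_in n (index_iota 0 N))) <=
   (2 * H).+1 ^ n.+1 + cnt_height n H (eis_in n (index_iota N H.+1)))%N.
Proof.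
rewrite -(cnt_setC n.+1 (- H%:Z) _ (eis_in n (index_iota 0 N))) addnAC leq_add2r.
apply: leq_trans (cnt_predU _ _ _ _ _); apply: cnt_le => f _ /hasP[p].
rewrite mem_index_iota /= => pH e; case: (ltnP p N) => pN; apply/orP; [left|right];
  by apply/hasP; exists p; rewrite // mem_index_iota ?pN.
Qed.

Local Open Scope classical_set_scope.

(** * Densities of periodic conditions *)

Lemma cvg_inv_odd (R : realType) : ((2 * H).+1%:R^-1 : R) @[H --> \oo] --> (0 : R).
Proof.
apply: (@squeeze_cvgr _ _ _ R (fun=> 0) harmonic); last 2 first.
- exact: cvg_cst.
- exact: cvg_harmonic.
apply: nearW => H /=; rewrite invr_ge0 ler0n /= lef_pV2 ?posrE ?ltr0n //.
by rewrite ler_nat; lia.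
Qed.

Lemma cvg_inv_odd_div (R : realType) n :
  ((2 * (H %/ 2 ^ n)).+1%:R^-1 : R) @[H --> \oo] --> (0 : R).
Proof.
apply: (@squeeze_cvgr _ _ _ R (fun=> 0) (fun H => 2 ^+ n.+1 * (2 * H).+1%:R^-1)); last 2 first.
- exact: cvg_cst.
- by rewrite -[X in _ --> X](mulr0 (2 ^+ n.+1)); apply: cvgMl_tmp; exact: cvg_inv_odd.
apply: nearW => H; rewrite invr_ge0 ler0n /= -[X in X <= _]mul1r.
rewrite ler_pdivrMr ?ltr0n // mulrAC ler_pdivlMr ?ltr0n // mul1r.
rewrite -natrX -natrM ler_nat expnS.
have : (0 < 2 ^ n)%N by rewrite expn_gt0.
by move=> /(ltn_ceil H); move: (2 ^ n)%N (H %/ 2 ^ n)%N => b q; nia.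
Qed.

(** With [b = 2^n] and [q = H %/ b], the numbers [b(2q+1)] and [2H+1] differ by at most [b], so the
    ratio is within [1/(2H+1)] of its limit. *)
Lemma cvg_odd_div_ratio (R : realType) n :
  ((2 * (H %/ 2 ^ n)).+1%:R / (2 * H).+1%:R : R) @[H --> \oo] --> ((2 ^+ n)^-1 : R).
Proof.
apply: (@squeeze_cvgr _ _ _ R (fun H => (2 ^+ n)^-1 - (2 * H).+1%:R^-1)
  (fun H => (2 ^+ n)^-1 + (2 * H).+1%:R^-1)); last 2 first.
- rewrite -[X in _ --> X]subr0; apply: cvgB; [exact: cvg_cst|exact: cvg_inv_odd].
- rewrite -[X in _ --> X]addr0; apply: cvgD; [exact: cvg_cst|exact: cvg_inv_odd].
apply: nearW => H; have b0 : (0 < 2 ^ n)%N by rewrite expn_gt0.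
have p0 : 0 < 2 ^+ n :> R by rewrite exprn_gt0.
have l0 : 0 < (2 * H).+1%:R :> R by rewrite ltr0n.
have h1 := leq_divM H (2 ^ n); have h2 := ltn_ceil H b0.
apply/andP; split; rewrite -(ler_pM2r l0) mulfVK ?gt_eqF // ?mulrBl ?mulrDl mulVf ?gt_eqF //;
  rewrite -(ler_pM2l p0) ?mulrBr ?mulrDr mulVKf ?gt_eqF // mulr1 -natrX -natrM.
- by rewrite lerBlDr -natrD ler_nat; move: b0 h1 h2; move: (2 ^ n)%N (H %/ 2 ^ n)%N => b q; nia.
- by rewrite -natrD ler_nat; move: b0 h1 h2; move: (2 ^ n)%N (H %/ 2 ^ n)%N => b q; nia.
Qed.

(** [cnt_bounds] squeezes the proportion between [k]-th powers of two sequences tending to [1/M],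
    times the number of good residues. *)
Lemma cvg_cnt_periodic (R : realType) k M A (c : nat -> int) (L : nat -> nat) :
  (0 < M)%N -> periodic_mod M A -> (forall H, 0 < L H)%N ->
  ((L H)%:R^-1 : R) @[H --> \oo] --> (0 : R) ->
  ((cnt k (c H) (L H) A)%:R / (L H)%:R ^+ k : R) @[H --> \oo] -->
  ((cnt_res k M A)%:R / M%:R ^+ k : R).
Proof.
move=> M0 pA L0 Lcvg; set S : R := (cnt_res k M A)%:R.
have M0r : 0 < M%:R :> R by rewrite ltr0n.
have L0r H : 0 < (L H)%:R :> R by rewrite ltr0n.
pose x H : R := (L H %/ M)%:R / (L H)%:R.
have xcvg : x H @[H --> \oo] --> (M%:R^-1 : R).
  apply: (@squeeze_cvgr _ _ _ R (fun H => M%:R^-1 - (L H)%:R^-1) (fun=> M%:R^-1)); last 2 first.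
  - rewrite -[X in _ --> X]subr0; apply: cvgB => //; exact: cvg_cst.
  - exact: cvg_cst.
  apply: nearW => H; rewrite /x.
  have h1 := leq_divM (L H) M; have h2 := ltn_ceil (L H) M0.
  apply/andP; split; rewrite -(ler_pM2r (L0r H)) mulfVK ?gt_eqF // ?mulrBl ?mulVf ?gt_eqF //;
    rewrite -(ler_pM2l M0r) ?mulrBr mulVKf ?gt_eqF // ?mulr1 -natrM.
  - by rewrite lerBlDr -natrD ler_nat; lia.
  - by rewrite ler_nat mulnC.
have ycvg : (x H + (L H)%:R^-1) @[H --> \oo] --> (M%:R^-1 : R).
  by rewrite -[X in _ --> X]addr0; apply: cvgD.
have pw (u : nat -> R) : u H @[H --> \oo] --> (M%:R^-1 : R) ->
    S * u H ^+ k @[H --> \oo] --> (S / M%:R ^+ k : R).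
  move=> ucvg; apply: cvgMl_tmp; rewrite -exprVn.
  exact: (cvg_comp u (fun y => y ^+ k) ucvg (@exprn_continuous R k _)).
apply: (squeeze_cvgr _ (pw _ xcvg) (pw _ ycvg)); apply: nearW => H.
rewrite /x -[X in _ <= S * (_ + X) ^+ k]mul1r -mulrDl natr1 !exprMn exprVn !mulrA.
have Le0 : 0 <= ((L H)%:R ^+ k)^-1 :> R by rewrite invr_ge0 exprn_ge0 // ltW.
have /andP[lb ub] := cnt_bounds k (c H) (L H) M0 pA.
by apply/andP; split; apply: ler_wpM2r => //; rewrite /S -natrX -natrM ler_nat.
Qed.

Lemma periodic_mod_predC M A : periodic_mod M A -> periodic_mod M (predC A).
Proof. by move=> pA f g fg; rewrite /= (pA f g). Qed.

Lemma periodic_mod_predI M A B : periodic_mod M A -> periodic_mod M B ->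
  periodic_mod M (predI A B).
Proof. by move=> pA pB f g fg; rewrite /= (pA f g) // (pB f g). Qed.

(** A common period of the conditions [eis n p] for the primes [p < N]. *)
Definition sqr_primorial (N : nat) : nat := (\prod_(0 <= p < N | prime p) p ^ 2)%N.

Lemma sqr_primorial_gt0 N : (0 < sqr_primorial N)%N.
Proof. by apply: prodn_cond_gt0 => p pp; rewrite expn_gt0 prime_gt0. Qed.

Lemma sqr_primorialS N : sqr_primorial N.+1 =
  (if prime N then sqr_primorial N * N ^ 2 else sqr_primorial N)%N.
Proof.
rewrite /sqr_primorial big_mkcond big_nat_recr //= -big_mkcond.
by case: ifP; rewrite ?muln1.
Qed.

Lemma coprime_sqr_primorial N : prime N -> coprime (sqr_primorial N) (N ^ 2).
Proof.
move=> pN; rewrite /sqr_primorial big_nat_cond.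
apply: (big_ind (fun m => coprime m (N ^ 2))); first exact: coprime1n.
  by move=> x y xN yN; rewrite coprimeMl xN.
move=> p /andP[/andP[_ pltN] pp]; rewrite coprimeXl // coprimeXr //.
by rewrite prime_coprime // dvdn_prime2 // neq_ltn pltN.
Qed.

Lemma no_eisS n N f : predC (eis_in n (index_iota 0 N.+1)) f =
  predC (eis_in n (index_iota 0 N)) f && ~~ (prime N && eis n N f).
Proof.
rewrite /= /eis_in /index_iota !subn0 -[in LHS]addn1 iotaD has_cat /=.
by rewrite orbF negb_or.
Qed.

Lemma no_eis_periodic n N :
  periodic_mod (sqr_primorial N) (predC (eis_in n (index_iota 0 N))).
Proof.
elim: N => [f g _ //|N IH] f g fg; rewrite !no_eisS; move: fg.
rewrite sqr_primorialS; case: ifP => pN fg; last by rewrite (IH f g).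
congr (_ && ~~ _); first by apply: (periodic_dvdn _ IH fg); rewrite dvdn_mulr.
by apply: (periodic_dvdn _ (@eis_periodic n N) fg); rewrite dvdn_mull.
Qed.

Lemma local_densityE (R : realType) n p : (0 < n)%N -> (0 < p)%N ->
  (cnt_res n.+1 (p ^ 2) (eis n p))%:R / (p ^ 2)%:R ^+ n.+1 = local_density R n p.
Proof.
move=> n0 p0; rewrite cnt_eis_residues // /local_density.
have pr0 : p%:R != 0 :> R by rewrite pnatr_eq0 -lt0n.
have -> : p.-1 = (p - 1)%N by rewrite subn1.
apply/eqP; rewrite eqr_div ?expf_neq0 // ?natrX ?expf_neq0 // natrM !natrX natrB //.
by rewrite -mulrA -exprD -exprM; apply/eqP; congr (_ * _ ^+ _); lia.
Qed.

(** Induction on [N]: a prime [N] brings a coprime modulus [N^2], so the proportion is multiplied by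
    that of the complement of [eis n N]. *)
Lemma no_eis_density (R : realType) n N : (0 < n)%N ->
  (cnt_res n.+1 (sqr_primorial N) (predC (eis_in n (index_iota 0 N))))%:R /
    (sqr_primorial N)%:R ^+ n.+1
  = \prod_(0 <= p < N | prime p) (1 - local_density R n p).
Proof.
move=> n0; elim: N => [|N IH].
  rewrite /sqr_primorial !big_nil expr1n divr1.
  have h := cnt_setC n.+1 0 1 (eis_in n (index_iota 0 0)); rewrite exp1n in h.
  have h0 : cnt n.+1 0 1 (eis_in n (index_iota 0 0)) = 0%N.
    by apply/eqP; rewrite /cnt cards_eq0; apply/eqP/setP => u; rewrite !inE.
  by rewrite h0 add0n in h; rewrite /cnt_res h.
rewrite [RHS]big_mkcond big_nat_recr //= -big_mkcond -IH sqr_primorialS.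
rewrite /cnt_res (eq_cnt (B := predI (predC (eis_in n (index_iota 0 N)))
  (fun f => ~~ (prime N && eis n N f)))); last by move=> f _; rewrite no_eisS.
case: (boolP (prime N)) => pN; last first.
  by rewrite mulr1; congr (_%:R / _); apply: eq_cnt => f _ /=; rewrite andbT.
rewrite (_ : cnt _ _ _ _ = cnt_res n.+1 (sqr_primorial N) (predC (eis_in n (index_iota 0 N)))
    * cnt_res n.+1 (N ^ 2) (predC (eis n N)))%N; last first.
  rewrite -cnt_coprime ?sqr_primorial_gt0 ?expn_gt0 ?prime_gt0 //.
  - exact: coprime_sqr_primorial.
  - exact: no_eis_periodic.
  - exact/periodic_mod_predC/eis_periodic.
rewrite natrM (natrM _ (sqr_primorial N)) exprMn -mulf_div; congr (_ * _).
have := cnt_setC n.+1 0 (N ^ 2) (eis n N); rewrite -/(cnt_res _ _ _) -/(cnt_res _ _ _).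
move=> /(congr1 (fun m => m%:R / (N ^ 2)%:R ^+ n.+1 : R)).
rewrite natrD mulrDl (natrX R (N ^ 2)) divff; last first.
  by rewrite expf_neq0 // pnatr_eq0 -lt0n expn_gt0 prime_gt0.
by rewrite (local_densityE R n0 (prime_gt0 pN)) => /(canRL (addKr _)) ->; rewrite addrC.
Qed.

Lemma eis_pair_periodic n p q : periodic_mod (p ^ 2 * q ^ 2) (eis_pair n p q).
Proof.
apply: periodic_mod_predI.
  by apply: periodic_dvdn (@eis_periodic n p); rewrite dvdn_mulr.
apply: periodic_dvdn (shift1_periodic (@eis_periodic n q)).
by rewrite dvdn_mull.
Qed.

(** The Chinese remainder theorem separates [p] from [q]; for [q], [cnt_shift1_residues] supplies
    the upper bound. *)
Lemma eis_pair_density (R : realType) n p q : (0 < n)%N -> prime p -> prime q ->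
  q != p ->
  (cnt_res n.+1 (p ^ 2 * q ^ 2) (eis_pair n p q))%:R / (p ^ 2 * q ^ 2)%:R ^+ n.+1
  <= local_density R n p * local_density R n q.
Proof.
move=> n0 pp pq qp; have [p0 q0] := (prime_gt0 pp, prime_gt0 pq).
rewrite /eis_pair cnt_coprime ?expn_gt0 ?p0 ?q0 //; last 3 first.
- by rewrite coprimeXl // coprimeXr // prime_coprime // dvdn_prime2 // eq_sym.
- exact: eis_periodic.
- exact/shift1_periodic/eis_periodic.
rewrite natrM (natrM _ (p ^ 2)) exprMn -mulf_div.
rewrite -(local_densityE R n0 p0) -(local_densityE R n0 q0).
apply: ler_wpM2l; first by rewrite divr_ge0 // exprn_ge0.
apply: ler_wpM2r; first by rewrite invr_ge0 exprn_ge0.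
by rewrite ler_nat cnt_shift1_residues ?expn_gt0 ?q0 //; apply: eis_periodic.
Qed.

(** * Sums and products over primes *)

Lemma sum_inv_sqr_le (R : realType) N m : (2 <= N)%N ->
  \sum_(N <= p < m) (p%:R ^+ 2)^-1 <= (N.-1)%:R^-1 :> R.
Proof.
move=> N2; case: (leqP m N) => [mN|/ltnW Nm].
  by rewrite big_geq // invr_ge0.
(* Telescoping, from [1/p^2 <= 1/(p-1) - 1/p]. *)
pose f p : R := - (p.-1)%:R^-1.
have: \sum_(N <= p < m) (p%:R ^+ 2)^-1 <= \sum_(N <= p < m) (f p.+1 - f p).
  rewrite big_nat_cond [leRHS]big_nat_cond; apply: ler_sum => p /andP[/andP[Np _] _].
  case: p Np => [|[|p]] Np; [lia|lia|rewrite /f /=].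
  have x0 : 0 < p.+1%:R :> R by rewrite ltr0n.
  rewrite -[p.+2%:R]natr1; move: (p.+1%:R : R) x0 => x x0.
  have -> : - (x + 1)^-1 - - x^-1 = (x * (x + 1))^-1 by field; lra.
  by rewrite lef_pV2 ?posrE; nra.
move=> /le_trans; apply; rewrite telescope_sumr // /f opprK addrC lerBlDr.
by rewrite lerDl invr_ge0.
Qed.

(** A union bound: since [n >= 2], [cnt_eis_le] reduces the tail to a sum of [1/p^2], uniformly in
    [H]. *)
Lemma tail_le (R : realType) n H N : (2 <= n)%N -> (2 <= N)%N ->
  (cnt_height n H (eis_in n (index_iota N H.+1)))%:R
  <= 2 ^+ n * 3 * harmonic N * (2 * H).+1%:R ^+ n.+1 :> R.
Proof.
move=> n2 N2; set L := (2 * H).+1.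
have L0 : 0 < L%:R ^+ n.+1 :> R by rewrite exprn_gt0 // ltr0n.
apply: (@le_trans _ _ (\sum_(N <= p < H.+1)
    (cnt_height n H (fun f => prime p && eis n p f))%:R)).
  by rewrite -natr_sum ler_nat; apply: cnt_has.
apply: (@le_trans _ _ (\sum_(N <= p < H.+1) (2 ^+ n * L%:R ^+ n.+1) * (p%:R ^+ 2)^-1)).
  rewrite big_nat_cond [leRHS]big_nat_cond; apply: ler_sum => p /andP[/andP[Np pH] _].
  have p1 : 1 <= p%:R :> R by rewrite ler1n; lia.
  have pn0 : 0 < p%:R ^+ n :> R by rewrite exprn_gt0 // (lt_le_trans ltr01).
  apply: (@le_trans _ _ ((2 ^+ n * L%:R ^+ n.+1) * (p%:R ^+ n)^-1)).
    rewrite ler_pdivlMr // -!natrX -!natrM ler_nat.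
    have pL : (0 < p <= L)%N by rewrite /L; lia.
    apply: leq_trans (cnt_eis_le n (- H%:Z) pL).
    by rewrite leq_mul2r; apply/orP; right; apply: cnt_le => f _ /andP[].
  apply: ler_wpM2l; first by rewrite mulr_ge0 ?exprn_ge0 // ltW.
  by rewrite lef_pV2 ?posrE ?exprn_gt0 ?(lt_le_trans ltr01) // ler_weXn2l.
rewrite -mulr_sumr.
have -> : 2 ^+ n * 3 * harmonic N * L%:R ^+ n.+1 = (2 ^+ n * L%:R ^+ n.+1) * (3 * harmonic N) :> R.
  by ring.
apply: ler_wpM2l; first by rewrite mulr_ge0 ?exprn_ge0 // ltW.
apply: le_trans (sum_inv_sqr_le R H.+1 N2) _; rewrite /harmonic /=.
(* [harmonic N] is [1/(N+1)], and [1/(N-1) <= 3/(N+1)] because [N >= 2]; hence the factor 3. *)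
rewrite ler_pdivlMr ?ltr0n // mulrC ler_pdivrMr ?ltr0n; last by lia.
by rewrite -natrM ler_nat; lia.
Qed.

Lemma local_density_ge0 (R : realType) n p : 0 <= local_density R n p.
Proof. by rewrite divr_ge0 ?sqr_ge0 ?exprn_ge0. Qed.

Lemma local_density_le (R : realType) n p : (2 <= n)%N -> (0 < p)%N ->
  local_density R n p <= p%:R^-1 - p.+1%:R^-1.
Proof.
move=> n2 p0; rewrite /local_density -natr1.
have x1 : 1 <= p%:R :> R by rewrite ler1n.
apply: (@le_trans _ _ ((p%:R - 1) ^+ 2 / p%:R ^+ 4)).
  apply: ler_wpM2l; first exact: sqr_ge0.
  by rewrite lef_pV2 ?posrE ?exprn_gt0 ?(lt_le_trans ltr01) // ler_weXn2l //; lia.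
move: (p%:R : R) x1 => x x1.
have -> : x^-1 - (x + 1)^-1 = (x * (x + 1))^-1 by field; lra.
rewrite ler_pdivrMr ?exprn_gt0 ?(lt_le_trans ltr01) // mulrC ler_pdivlMr; last by nra.
(* This is exactly [x^4 - x (x+1) (x-1)^2], the gap after clearing denominators. *)
have : 0 <= x * (x ^+ 2 + x - 1) by nra.
nra.
Qed.

Lemma local_density_gt0 (R : realType) n p : (2 <= p)%N -> 0 < local_density R n p.
Proof.
move=> p2; rewrite divr_gt0 ?exprn_gt0 ?ltr0n //; last by lia.
by rewrite subr_gt0 ltr1n.
Qed.

Lemma local_density_le1 (R : realType) n p : (2 <= n)%N -> (0 < p)%N ->
  local_density R n p <= 1.
Proof.
move=> n2 p0; apply: le_trans (local_density_le R n2 p0) _.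
have : p%:R^-1 <= 1 :> R by rewrite invf_le1 ?ler1n ?ltr0n.
have : 0 <= p.+1%:R^-1 :> R by rewrite invr_ge0.
by move: (p.+1%:R^-1 : R) (p%:R^-1 : R) => a b; lra.
Qed.

Lemma big_nat_recr_cond (T : Type) (idx : T) (op : Monoid.law idx) N (P : pred nat) F :
  \big[op/idx]_(0 <= p < N.+1 | P p) F p =
  (if P N then op (\big[op/idx]_(0 <= p < N | P p) F p) (F N)
   else \big[op/idx]_(0 <= p < N | P p) F p).
Proof.
rewrite big_mkcond big_nat_recr //= -big_mkcond.
by case: (P N) => //; rewrite Monoid.mulm1.
Qed.

Lemma sum_local_density_le (R : realType) n N : (2 <= n)%N ->
  \sum_(0 <= p < N | prime p) local_density R n p <= 2^-1.
Proof.
(* The sharper bound carries the induction: the terms are dominated by [1/p - 1/(p+1)], telescoping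
   from [p = 2]. *)
move=> n2; suff : (2 <= N)%N -> \sum_(0 <= p < N | prime p) local_density R n p
    <= 2^-1 - N%:R^-1.
  case: N => [|[|N]] h; first by rewrite big_geq // invr_ge0.
    by rewrite big_nat_recr_cond /= big_geq // invr_ge0.
  by apply: le_trans (h isT) _; rewrite lerBlDr lerDl invr_ge0.
elim: N => // N IH; rewrite ltnS leq_eqVlt => /predU1P[<-|N2].
  by rewrite !big_nat_recr_cond /= big_geq // subrr.
have {}IH := IH N2; rewrite big_nat_recr_cond /=.
have := local_density_le R n2 (ltnW N2); have := local_density_ge0 R n N.
by move: (N.+1%:R^-1 : R) (N%:R^-1 : R) IH => a b IH; case: ifP => _; lra.
Qed.

Section PrimeSequences.
Variables (R : realType) (n : nat) (n2 : (2 <= n)%N).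

Definition no_eis_prod N : R := \prod_(0 <= p < N | prime p) (1 - local_density R n p).
Definition density_sum N : R := \sum_(0 <= p < N | prime p) local_density R n p.
Definition density_sqr_sum N : R := \sum_(0 <= p < N | prime p) local_density R n p ^+ 2.

Let d01 p : prime p -> 0 <= local_density R n p <= 1.
Proof. by move=> pp; rewrite local_density_ge0 local_density_le1 ?prime_gt0. Qed.

(** Monotone and bounded, so the [limn] in [prime_sum] is a genuine limit. *)
Lemma density_sum_cvg : density_sum N @[N --> \oo] --> prime_sum (local_density R n).
Proof.
apply: nondecreasing_is_cvgn.
  apply/nondecreasing_seqP => N; rewrite /density_sum big_nat_recr_cond.
  by case: ifP => //= _; rewrite lerDl local_density_ge0.
by exists 2^-1 => _ [N _ <-]; apply: sum_local_density_le.
Qed.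

Lemma density_sqr_sum_cvg : density_sqr_sum N @[N --> \oo] -->
  prime_sum (fun p => (p%:R - 1) ^+ 4 / p%:R ^+ (2 * n + 4) : R).
Proof.
rewrite (_ : (fun p : nat => _ / _) = fun p => local_density R n p ^+ 2); last first.
  apply/funext => p; rewrite /local_density expr_div_n -!exprM.
  by congr (_ / _ ^+ _); lia.
apply: nondecreasing_is_cvgn.
  apply/nondecreasing_seqP => N; rewrite /density_sqr_sum big_nat_recr_cond.
  by case: ifP => //= _; rewrite lerDl sqr_ge0.
exists 2^-1 => _ [N _ <-]; apply: le_trans (sum_local_density_le R N n2).
by apply: ler_sum => p /d01/andP[d0 d1]; rewrite expr2 ler_piMr.
Qed.

Lemma no_eis_prod_ge0 N : 0 <= no_eis_prod N.
Proof. by apply: prodr_ge0 => p /d01/andP[_ d1]; rewrite subr_ge0. Qed.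

Lemma no_eis_prod_cvg :
  no_eis_prod N @[N --> \oo] --> prime_prod (fun p => 1 - local_density R n p).
Proof.
apply: nonincreasing_is_cvgn.
  apply/nonincreasing_seqP => N; rewrite {1}/no_eis_prod big_nat_recr_cond.
  case: ifP => //= _; rewrite ler_piMr ?no_eis_prod_ge0 //.
  by rewrite lerBlDr lerDl local_density_ge0.
by exists 0 => _ [N _ <-]; apply: no_eis_prod_ge0.
Qed.

(* Second-order Bonferroni inequality for independent events. *)
Lemma no_eis_prod_le N :
  no_eis_prod N <= 1 - density_sum N + density_sum N ^+ 2 / 2.
Proof.
elim: N => [|N]; first by rewrite /no_eis_prod /density_sum !big_geq //; lra.
rewrite /no_eis_prod /density_sum !big_nat_recr_cond; case: ifP => //= pN.
rewrite -/(no_eis_prod N) -/(density_sum N) => IH.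
have /andP[d0 d1] := d01 pN; move: (local_density R n N) d0 d1 => d d0 d1.
move: (no_eis_prod N) (density_sum N) IH => P s IH.
(* Multiplying the induction hypothesis by [1 - d] leaves a slack of [(d s^2 + d^2)/2]. *)
have : 0 <= d * s ^+ 2 by rewrite mulr_ge0 // sqr_ge0.
have : 0 <= d ^+ 2 by apply: sqr_ge0.
have : 0 <= (1 - d) * (1 - s + s ^+ 2 / 2 - P) by rewrite mulr_ge0 // subr_ge0.
nra.
Qed.

(** With [s] the sum of the densities, [rho >= s - s^2/2] and [tau <= s^2]. As [0 < s <= 1/2], the
    difference is at least [s (1 - 3s/2) > 0]. *)
Lemma rho_gt_tau : 0 < eis_rho R n /\ 0 < eis_rho R n - eis_tau R n.
Proof.
pose s := prime_sum (local_density R n).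
have s2 : s <= 2^-1.
  by apply: (cvgr_to_le density_sum_cvg); apply: nearW => N; apply: sum_local_density_le.
have s0 : 0 < s.
  apply: (@lt_le_trans _ _ (local_density R n 2)); first exact: local_density_gt0.
  apply: (cvgr_to_ge density_sum_cvg); exists 3%N => // N /= N3.
  rewrite /density_sum (big_cat_nat _ (n := 3%N)) //= !big_nat_recr_cond /= big_geq // add0r.
  by rewrite lerDl sumr_ge0 // => p _; apply: local_density_ge0.
have t0 : 0 <= prime_sum (fun p => (p%:R - 1) ^+ 4 / p%:R ^+ (2 * n + 4) : R).
  apply: (cvgr_to_ge density_sqr_sum_cvg); apply: nearW => N.
  by apply: sumr_ge0 => p _; apply: sqr_ge0.
have P2 : prime_prod (fun p => 1 - local_density R n p) <= 1 - s + s ^+ 2 / 2.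
  apply: (ler_cvg_to no_eis_prod_cvg (g := fun N => 1 - density_sum N + density_sum N ^+ 2 / 2)).
    apply: cvgD; first by apply: cvgB; [exact: cvg_cst|exact: density_sum_cvg].
    apply: cvgMr_tmp; rewrite expr2; under eq_fun do rewrite expr2.
    by apply: cvgM; exact: density_sum_cvg.
  by apply: nearW => N; apply: no_eis_prod_le.
by rewrite /eis_rho /eis_tau -/s; split; nra.
Qed.

End PrimeSequences.

Lemma cvg_sumr (R : realType) (I : Type) (r : seq I) (P : pred I)
    (F : I -> nat -> R) (l : I -> R) :
  (forall i, P i -> F i H @[H --> \oo] --> l i) ->
  \sum_(i <- r | P i) F i H @[H --> \oo] --> \sum_(i <- r | P i) l i.
Proof.
move=> Fl; elim: r => [|i r IH].
  by under eq_fun do rewrite big_nil; rewrite big_nil; exact: cvg_cst.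
rewrite big_cons; under eq_fun do rewrite big_cons.
by case: ifP => // Pi; apply: cvgD => //; apply: Fl.
Qed.

(** The right-hand side is [eis_tau] truncated at [N]: a square minus its diagonal. *)
Lemma sum_distinct_pairs (R : realType) n N :
  \sum_(0 <= p < N | prime p) \sum_(0 <= q < N | prime q && (q != p))
    local_density R n p * local_density R n q
  = density_sum R n N ^+ 2 - density_sqr_sum R n N.
Proof.
rewrite /density_sum /density_sqr_sum expr2 mulr_suml -sumrB.
rewrite big_nat_cond [RHS]big_nat_cond; apply: eq_bigr => p /andP[/andP[_ pN] pp].
rewrite -mulr_sumr expr2 -mulrBr; congr (_ * _).
rewrite [X in X - _](bigID (pred1 p)) /= big_nat1_cond_eq pN pp /=.
by rewrite addrAC subrr add0r.
Qed.

Lemma limn_einf_ge (R : realType) (u : nat -> \bar R) (a : \bar R) :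
  (\forall H \near \oo, a <= u H)%E -> (a <= limn_einf u)%E.
Proof.
move=> [N _ uN]; rewrite limn_einf_lim; apply: lime_ge; first exact: is_cvg_einfs.
exists N => // m /= Nm; rewrite /einfs /=; apply: le_ereal_inf_tmp => _ [p /= pm <-].
by apply: uN => /=; apply: leq_trans pm.
Qed.

(** * The gain from shifting *)

Section Gain.
Variables (R : realType) (n : nat) (n2 : (2 <= n)%N).

Local Notation side H := (2 * H)%N.+1%:R.
Let h H := (H %/ 2 ^ n)%N.
Let eps N : R := 2 ^+ n * 3 * harmonic N.

Let no_eis_freq N (H : nat) : R :=
  (cnt_height n H (predC (eis_in n (index_iota 0 N))))%:R / side H ^+ n.+1.

Let pair_freq N (H : nat) : R :=
  \sum_(0 <= p < N | prime p) \sum_(0 <= q < N | prime q && (q != p))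
    (cnt_height n H (eis_pair n p q))%:R / side H ^+ n.+1.

(** The power of the ratio of sides converts proportions in the small box to the large one; [eps N]
    is already relative to the large box. *)
Let gain_bound N (H : nat) : R :=
  (side (h H) / side H) ^+ n.+1 * (1 - no_eis_freq N (h H) - pair_freq N (h H)) - eps N.

Let n0 : (0 < n)%N. Proof. exact: ltnW. Qed.

Lemma gain_lower N H : (2 <= N)%N ->
  gain_bound N H * side H ^+ n.+1 <= (cnt_height n (h H) (shift_gain n H))%:R.
Proof.
move=> N2; have hH : (2 ^ n * h H <= H)%N by rewrite mulnC leq_divM.
have L0 : (side H ^+ n.+1 : R) != 0 by rewrite expf_neq0 // pnatr_eq0.
have l0 : (side (h H) ^+ n.+1 : R) != 0 by rewrite expf_neq0 // pnatr_eq0.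
have := cnt_gain_lower N n0 hH; rewrite -(ler_nat R) !natrD natrX natr_sum.
under eq_bigr do rewrite natr_sum.
have := tail_le R H n2 N2; rewrite -/(eps N) => tl c.
have E : gain_bound N H * side H ^+ n.+1 = side (h H) ^+ n.+1
   - (cnt_height n (h H) (predC (eis_in n (index_iota 0 N))))%:R
   - \sum_(0 <= p < N | prime p) \sum_(0 <= q < N | prime q && (q != p))
       (cnt_height n (h H) (eis_pair n p q))%:R - eps N * side H ^+ n.+1.
  rewrite /gain_bound mulrBl expr_div_n mulrAC mulfVK // !mulrBr mulr1; congr (_ - _ - _ - _).
    by rewrite /no_eis_freq mulrC mulfVK.
  rewrite /pair_freq mulr_sumr; apply: eq_bigr => p _; rewrite mulr_sumr.
  by apply: eq_bigr => q _; rewrite mulrC mulfVK.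
by rewrite E; lra.
Qed.

Lemma Eis_upper N H : (2 <= N)%N ->
  (cnt_height n H (eis_in n (index_iota 0 H.+1)))%:R
  <= (1 - no_eis_freq N H + eps N) * side H ^+ n.+1.
Proof.
move=> N2; have L0 : (side H ^+ n.+1 : R) != 0 by rewrite expf_neq0 // pnatr_eq0.
have := cnt_Eis_upper n H N; rewrite -(ler_nat R) !natrD natrX.
have := tail_le R H n2 N2; rewrite -/(eps N) => tl c.
by rewrite mulrDl mulrBl mul1r /no_eis_freq mulfVK //; lra.
Qed.

Lemma no_eis_freq_cvg N (u : nat -> nat) :
  (side (u H))^-1 @[H --> \oo] --> (0 : R) ->
  no_eis_freq N (u H) @[H --> \oo] --> no_eis_prod R n N.
Proof.
move=> ucvg; rewrite /no_eis_prod -no_eis_density //.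
apply: (@cvg_cnt_periodic R _ _ _ (fun H => - (u H)%:Z) (fun H => (2 * u H).+1)) => //.
- exact: sqr_primorial_gt0.
- exact: no_eis_periodic.
Qed.

(** An upper bound on the limit suffices, since pairs are subtracted from the gain. *)
Lemma pair_freq_cvg N (u : nat -> nat) :
  (side (u H))^-1 @[H --> \oo] --> (0 : R) ->
  exists2 D : R, pair_freq N (u H) @[H --> \oo] --> D
    & D <= density_sum R n N ^+ 2 - density_sqr_sum R n N.
Proof.
move=> ucvg; exists (\sum_(0 <= p < N | prime p) \sum_(0 <= q < N | prime q && (q != p))
   (cnt_res n.+1 (p ^ 2 * q ^ 2) (eis_pair n p q))%:R / (p ^ 2 * q ^ 2)%:R ^+ n.+1).
  apply: cvg_sumr => p pp; apply: cvg_sumr => q /andP[pq _].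
  apply: (@cvg_cnt_periodic R _ _ _ (fun H => - (u H)%:Z) (fun H => (2 * u H).+1)) => //.
  - by rewrite muln_gt0 !expn_gt0 !prime_gt0.
  - exact: eis_pair_periodic.
rewrite -sum_distinct_pairs; apply: ler_sum => p pp; apply: ler_sum => q /andP[pq qp].
exact: eis_pair_density.
Qed.

(** Two successive limits: [N] is fixed so that the truncated inequality is strict, then [H] tends
    to infinity with [N] fixed. *)
Lemma gain_eventually (g : R) : 0 <= g -> g < eis_gamma R n ->
  \forall H \near \oo, g * (card_set (Eis n H))%:R
                       < (cnt_height n (h H) (shift_gain n H))%:R.
Proof.
move=> g0 gg; set a : R := (2 ^+ n)^-1 ^+ n.+1.
have [r0 rt0] := rho_gt_tau R n2.
have lim_pos : 0 < a * (eis_rho R n - eis_tau R n) - g * eis_rho R n.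
  (* [a] is the limit of the ratio of box volumes, that is [1/2^(n^2+n)]. *)
  have -> : a * (eis_rho R n - eis_tau R n) = eis_gamma R n * eis_rho R n.
    have e : (1 - eis_tau R n / eis_rho R n) * eis_rho R n = eis_rho R n - eis_tau R n.
      by rewrite [LHS]mulrBl mul1r mulfVK ?gt_eqF.
    rewrite /eis_gamma -[RHS]mulrA e /a exprVn -exprM div1r.
    by congr (_ ^-1 * _); congr (_ ^+ _); lia.
  by rewrite subr_gt0 ltr_pM2r.
(* A lower bound for the limit in [H] of the normalized gain minus [g] times the Eisenstein bound,
   at truncation [N]. *)
pose G N : R := a * (1 - no_eis_prod R n N
    - (density_sum R n N ^+ 2 - density_sqr_sum R n N)) - eps N
  - g * (1 - no_eis_prod R n N + eps N).
have epscvg : eps N @[N --> \oo] --> (0 : R).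
  by rewrite -[X in _ --> X](mulr0 (2 ^+ n * 3)); apply: cvgMl_tmp; exact: cvg_harmonic.
have Pcvg : (1 - no_eis_prod R n N) @[N --> \oo] --> eis_rho R n.
  by apply: cvgB; [exact: cvg_cst|exact: no_eis_prod_cvg].
have Gcvg : G N @[N --> \oo] --> a * (eis_rho R n - eis_tau R n) - g * eis_rho R n.
  rewrite -[X in X - _]subr0 -[X in _ - _ * X]addr0.
  apply: cvgB; last by apply: cvgMl_tmp; apply: cvgD.
  apply: cvgB => //; apply: cvgMl_tmp; apply: cvgB => //.
  apply: cvgB; last exact: density_sqr_sum_cvg.
  rewrite expr2; under eq_fun do rewrite expr2.
  by apply: cvgM; exact: density_sum_cvg.
have [N N2 GN] : exists2 N, (2 <= N)%N & 0 < G N.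
  have [N0 _ hN] := cvgr_gt _ Gcvg _ lim_pos.
  by exists (maxn N0 2); rewrite ?leq_maxr //; apply: hN; rewrite /= leq_maxl.
have [D Dcvg DN] := pair_freq_cvg N (@cvg_inv_odd_div R n).
have cvgH : (gain_bound N H - g * (1 - no_eis_freq N H + eps N)) @[H --> \oo] -->
    a * (1 - no_eis_prod R n N - D) - eps N - g * (1 - no_eis_prod R n N + eps N).
  apply: cvgB.
    apply: cvgB; last exact: cvg_cst.
    apply: cvgM.
      exact: (cvg_comp _ (fun y => y ^+ n.+1) (@cvg_odd_div_ratio R n) (@exprn_continuous R _ _)).
    apply: cvgB => //; apply: cvgB; first exact: cvg_cst.
    by apply: no_eis_freq_cvg; exact: cvg_inv_odd_div.
  apply: cvgMl_tmp; apply: cvgD; last exact: cvg_cst.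
  apply: cvgB; first exact: cvg_cst.
  by apply: no_eis_freq_cvg; exact: cvg_inv_odd.
have a0 : 0 <= a by rewrite exprn_ge0 // invr_ge0 exprn_ge0.
(* Replacing [D] by its upper bound only decreases the value, as [a >= 0], and gives [G N]. *)
have pos : 0 < a * (1 - no_eis_prod R n N - D) - eps N - g * (1 - no_eis_prod R n N + eps N).
  apply: lt_le_trans GN _; rewrite /G !lerD2r ler_wpM2l // lerD2l lerN2 //.
apply: filterS (cvgr_gt _ cvgH _ pos) => H gH.
apply: lt_le_trans (gain_lower H N2).
rewrite card_EisE //; apply: le_lt_trans (ler_wpM2l g0 (Eis_upper H N2)) _.
rewrite mulrA -subr_gt0 -mulrBl mulr_gt0 // exprn_gt0 // ltr0n //.
Qed.

Lemma ratio_eventually (g : R) : 0 <= g -> g < eis_gamma R n ->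
  \forall H \near \oo, 1 + g <= eis_ratio R n H.
Proof.
move=> g0 /(gain_eventually g0); apply: filterS => H gain.
have hH : (2 ^ n * h H <= H)%N by rewrite mulnC leq_divM.
(* The quotient is meaningful: the gain is positive, and gained polynomials are themselves
   Eisenstein of height at most [H]. *)
have E0 : 0 < (card_set (Eis n H))%:R :> R.
  have : 0 < (cnt_height n (h H) (shift_gain n H))%:R :> R.
    by apply: le_lt_trans gain; rewrite mulr_ge0.
  rewrite !ltr0n card_EisE // => /leq_trans; apply.
  apply: (cnt_le_inj (phi := id)) => // f /andP[sf /forallP fb] /andP[-> _].
  rewrite andbT /in_box sf; apply/forallP => i; have := fb i.
  have : (h H <= H)%N by apply: leq_div.
  lia.
rewrite /eis_ratio ler_pdivlMr // mulrDl mul1r.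
apply: le_trans (_ : _ <= (card_set (Eis n H) + cnt_height n (h H) (shift_gain n H))%:R) _.
  by rewrite natrD lerD2l ltW.
by rewrite ler_nat; apply: shiftedEis_gain.
Qed.

End Gain.

Theorem theorem8 (R : realType) (n : nat) (hn : (2 <= n)%N) :
  0 < eis_gamma R n /\
  ((1 + eis_gamma R n)%:E <= limn_einf (fun H : nat => (eis_ratio R n H)%:E))%E.
Proof.
have [r0 rt0] := rho_gt_tau R hn.
have g0 : 0 < eis_gamma R n.
  rewrite /eis_gamma mulr_gt0 ?divr_gt0 ?exprn_gt0 //.
  by rewrite subr_gt0 ltr_pdivrMr // mul1r -subr_gt0.
split=> //; apply/lee_addgt0Pr => e e0.
(* The minimum keeps [eis_gamma R n - d] nonnegative, as [ratio_eventually] requires. *)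
pose d := Num.min e (eis_gamma R n).
have d0 : 0 < d by rewrite lt_min e0.
have := @ratio_eventually R n hn (eis_gamma R n - d).
rewrite subr_ge0 ge_min lexx orbT ltrBlDr ltrDl => /(_ isT d0) ev.
have : ((1 + (eis_gamma R n - d))%:E <= limn_einf (fun H : nat => (eis_ratio R n H)%:E))%E.
  by apply: limn_einf_ge; apply: filterS ev => H; rewrite lee_fin.
move=> /(leeD2r e%:E); apply: le_trans.
have de : d <= e by rewrite ge_min lexx.
by rewrite -EFinD lee_fin; lra.
Qed.
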